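(* Let $(\mathbb{X},\oplus,\otimes,\mathbb{0},\mathbb{1})$ be a selective idempotent semifield, and let $\bm{A}\in\mathbb{X}^{k\times n}$ and $\bm{B}\in\mathbb{X}^{n\times k}$ be any matrices. The system of inequalities $$\bm{A}\bm{x}\leq\bm{y},\qquad\bm{B}\bm{y}\leq\bm{x}$$ in the unknown vectors $\bm{x}\in\mathbb{X}^{n}$ and $\bm{y}\in\mathbb{X}^{k}$ has regular solutions (pairs of regular vectors $\bm{x},\bm{y}$ satisfying it) if and only if $$\operatorname{Tr}(\bm{A}\bm{B})\leq\mathbb{1}.$$ Under this condition, all regular solutions are given in parametric form by $$\bm{x}=(\bm{B}\bm{A})^{\ast}\bm{u}\oplus\bm{B}(\bm{A}\bm{B})^{\ast}\bm{v},\qquad\bm{y}=\bm{A}(\bm{B}\bm{A})^{\ast}\bm{u}\oplus(\bm{A}\bm{B})^{\ast}\bm{v},$$ where $\bm{u}\in\mathbb{X}^{n}$ and $\bm{v}\in\mathbb{X}^{k}$ are any parameter vectors such that both $\bm{x}$ and $\bm{y}$ are regular; that is, a pair of regular vectors $(\bm{x},\bm{y})$ is a solution if and only if it has this form for some $\bm{u},\bm{v}$.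
   Context: Idempotent semifield: a set $\mathbb{X}$ with associative and commutative operations $\oplus$ and $\otimes$ having distinct neutral elements $\mathbb{0}$ and $\mathbb{1}$ respectively, such that $(\mathbb{X},\oplus,\mathbb{0})$ is an idempotent commutative monoid ($x\oplus x=x$), $(\mathbb{X}\setminus\{\mathbb{0}\},\otimes,\mathbb{1})$ is an Abelian group, and $\otimes$ distributes over $\oplus$ (so that $\mathbb{0}\otimes x=\mathbb{0}$). The sign $\otimes$ is omitted. The order is $x\leq y$ iff $x\oplus y=y$. The semifield is selective: $x\oplus y\in\{x,y\}$ for all $x,y$, so the order is total. Matrices and vectors: $\mathbb{X}^{m\times n}$ is the set of $m\times n$ matrices over $\mathbb{X}$, and $\mathbb{X}^{n}$ the set of column vectors with $n$ elements. Matrix addition and multiplication are the usual ones with $\oplus,\otimes$ replacing $+,\times$; inequalities are componentwise. A vector is regular if it has no element equal to $\mathbb{0}$. $\bm{I}$ is the identity matrix ($\mathbb{1}$ on the diagonal, $\mathbb{0}$ elsewhere). For a square matrix $\bm{M}\in\mathbb{X}^{n\times n}$: $\bm{M}^{0}=\bm{I}$, $\bm{M}^{p}=\bm{M}\bm{M}^{p-1}$ for $p\geq 1$; $\operatorname{tr}\bm{M}=\bigoplus_{i=1}^{n}m_{ii}$; $\operatorname{Tr}(\bm{M})=\bigoplus_{i=1}^{n}\operatorname{tr}(\bm{M}^{i})$. The Kleene star is $\bm{M}^{\ast}=\bigoplus_{i\geq0}\bm{M}^{i}$, which, whenever $\operatorname{Tr}(\bm{M})\leq\mathbb{1}$, equals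 the finite sum $\bigoplus_{i=0}^{n-1}\bm{M}^{i}$ (Kleene stars are used only under this condition). *)

(* Defs.v *)
From HB Require Import structures.
From mathcomp Require Import all_boot all_order all_algebra.
From mathcomp Require Import boolp classical_sets.

Set Implicit Arguments.
Unset Strict Implicit.
Unset Printing Implicit Defensive.

Import GRing.Theory.

Local Open Scope classical_set_scope.
Local Open Scope ring_scope.

(* The operations oplus, otimes of a semifield, with neutral elements 0 <> 1,   *)
(* are the +, *, 0, 1 of a nontrivial commutative semiring.                     *)
HB.mixin Record isIdempotentSemifield X of GRing.ComNzSemiRing X := {
  semifield_addxx : idempotent_op (+%R : X -> X -> X);
  semifield_mulVx_ex : forall x : X, x != 0 -> exists y : X, y * x = 1
}.

#[short(type="idempotentSemifieldType")]
HB.structure Definition IdempotentSemifield :=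
  {X of isIdempotentSemifield X & GRing.ComNzSemiRing X}.

HB.mixin Record isSelective X of IdempotentSemifield X := {
  semifield_add_selective : forall x y : X, x + y = x \/ x + y = y
}.

#[short(type="selectiveSemifieldType")]
HB.structure Definition SelectiveSemifield :=
  {X of isSelective X & IdempotentSemifield X}.

Definition sle (X : idempotentSemifieldType) (x y : X) : bool := x + y == y.

Definition sle_mx (X : idempotentSemifieldType) (m n : nat)
    (M N : 'M[X]_(m, n)) : Prop :=
  forall i j, sle (M i j) (N i j).

Definition regular (X : idempotentSemifieldType) (n : nat) (x : 'cV[X]_n) :
    Prop :=
  forall i, x i 0 != 0.

Definition Tr (X : idempotentSemifieldType) (n : nat) (M : 'M[X]_n) : X :=
  \sum_(1 <= i < n.+1) \tr (M ^+ i).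

Definition is_lub_powers (X : idempotentSemifieldType) (n : nat)
    (M S : 'M[X]_n) : Prop :=
  (forall p : nat, sle_mx (M ^+ p) S) /\
  (forall T : 'M[X]_n, (forall p : nat, sle_mx (M ^+ p) T) -> sle_mx S T).

(* The infinite sum of all powers of M is their least upper bound, with the     *)
(* junk value 0 when there is none.                                             *)
Definition kleene_star (X : idempotentSemifieldType) (n : nat) (M : 'M[X]_n) :
    'M[X]_n :=
  xget 0 [set S | is_lub_powers M S].

Definition is_solution (X : idempotentSemifieldType) (k n : nat)
    (A : 'M[X]_(k, n)) (B : 'M[X]_(n, k)) (x : 'cV[X]_n) (y : 'cV[X]_k) :
    Prop :=
  sle_mx (A *m x) y /\ sle_mx (B *m y) x.

(* Main.v *)
Require Import Defs.
From mathcomp Require Import all_boot all_order all_algebra.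
From mathcomp Require Import boolp classical_sets.

(** If [A x <= y] and [B y <= x] then [A B y <= y], hence [(A B)^p y <= y] for
    every [p]; when [y] is regular, its entries can be cancelled on the diagonal,
    so every cyclic product of [A B] is at most [1], which is [Tr (A B) <= 1].

    Conversely, suppose [Tr M <= 1] for [M] of order [n].  An entry of [M^n] is
    the sum, that is, the supremum of the weights of the walks with [n] steps; by
    the pigeonhole principle such a walk contains a cycle of at most [n] steps,
    whose weight is at most [Tr M <= 1], and cutting it out leaves a walk with
    fewer than [n] steps.  So [M^n] lies
    below [S = I + M + ... + M^(n-1)] ([expmx_size_sle]), which gives
    [M S <= S]; all the powers of [M] are then below [S], and [S] is the Kleene
    star of [M] ([kleene_starE]).  The diagonal of [S] is at most [1], so the
    same holds for every power of [M], and by cyclicity of the trace the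
    condition passes from [A B] to [B A] ([Tr_mulC_sle1]).

    Two properties of the stars then finish the proof.  From [M M^* <= M^*], any
    pair of the parametric form is a solution; with [u] and [v] the all-ones
    vectors it is regular because [I <= M^*].  And [M z <= z] implies
    [M^* z = z], so that a solution [(x, y)] is its own parametric form with
    [u = x] and [v = y]. *)

Set Implicit Arguments.
Unset Strict Implicit.
Unset Printing Implicit Defensive.

Import GRing.Theory.

Local Open Scope ring_scope.

(** * The order of an idempotent semifield *)

Section Order.
Variable X : idempotentSemifieldType.
Implicit Types (x y z : X).

Lemma sle_refl x : sle x x.
Proof. by apply/eqP; exact: semifield_addxx. Qed.

Lemma sle_trans y x z : sle x y -> sle y z -> sle x z.
Proof. by move=> /eqP xy /eqP yz; apply/eqP; rewrite -yz addrA xy. Qed.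

Lemma sle_anti x y : sle x y -> sle y x -> x = y.
Proof. by move=> /eqP xy /eqP yx; rewrite -xy addrC yx. Qed.

Lemma sle_addr x y : sle x (x + y).
Proof. by apply/eqP; rewrite addrA semifield_addxx. Qed.

Lemma sle_addl x y : sle x (y + x).
Proof. by rewrite addrC sle_addr. Qed.

Lemma sle_add_lub x y z : sle x z -> sle y z -> sle (x + y) z.
Proof. by move=> /eqP xz /eqP yz; apply/eqP; rewrite -addrA yz. Qed.

Lemma sle_mul x x' y y' : sle x x' -> sle y y' -> sle (x * y) (x' * y').
Proof.
move=> /eqP xx' /eqP yy'; apply: (@sle_trans (x * y')); apply/eqP.
  by rewrite -mulrDr yy'.
by rewrite -mulrDl xx'.
Qed.

Lemma sle_sum_lub (I : Type) (r : seq I) (P : pred I) (F : I -> X) z :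
  (forall i, P i -> sle (F i) z) -> sle (\sum_(i <- r | P i) F i) z.
Proof.
move=> Fz; elim/big_ind: _ => //; first by apply/eqP; rewrite add0r.
by move=> *; exact: sle_add_lub.
Qed.

Lemma sle_sum_term (I : eqType) (r : seq I) (F : I -> X) (i : I) :
  i \in r -> sle (F i) (\sum_(j <- r) F j).
Proof. by move=> ir; rewrite (big_rem i ir) /= sle_addr. Qed.

Lemma sle_neq0 x y : sle x y -> x != 0 -> y != 0.
Proof. by move=> /eqP xy; apply: contra => /eqP y0; rewrite y0 addr0 in xy; apply/eqP. Qed.

Lemma sle_cancel x y : y != 0 -> sle (x * y) y -> sle x 1.
Proof.
move=> /semifield_mulVx_ex [z zy] /eqP xy; apply/eqP.
have := congr1 ( *%R^~ z) xy.
by rewrite -{2}[y]mul1r -mulrDl -mulrA [y * z]mulrC zy mulr1.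
Qed.

End Order.

(** * The componentwise order on matrices *)

Section MatrixOrder.
Variable X : idempotentSemifieldType.

Lemma sle_mx_refl m n (M : 'M[X]_(m, n)) : sle_mx M M.
Proof. by move=> i j; exact: sle_refl. Qed.

Lemma sle_mx_trans m n (N M P : 'M[X]_(m, n)) :
  sle_mx M N -> sle_mx N P -> sle_mx M P.
Proof. by move=> MN NP i j; apply: sle_trans (MN i j) (NP i j). Qed.

Lemma sle_mx_anti m n (M N : 'M[X]_(m, n)) : sle_mx M N -> sle_mx N M -> M = N.
Proof. by move=> MN NM; apply/matrixP => i j; apply: sle_anti. Qed.

Lemma sle_mx_addr m n (M N : 'M[X]_(m, n)) : sle_mx M (M + N).
Proof. by move=> i j; rewrite mxE sle_addr. Qed.

Lemma sle_mx_addl m n (M N : 'M[X]_(m, n)) : sle_mx M (N + M).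
Proof. by move=> i j; rewrite mxE sle_addl. Qed.

Lemma sle_mx_add_lub m n (M N P : 'M[X]_(m, n)) :
  sle_mx M P -> sle_mx N P -> sle_mx (M + N) P.
Proof. by move=> MP NP i j; rewrite mxE sle_add_lub. Qed.

Lemma sle_mx_sum_lub m n p (F : 'I_p -> 'M[X]_(m, n)) (P : 'M[X]_(m, n)) :
  (forall t, sle_mx (F t) P) -> sle_mx (\sum_(t < p) F t) P.
Proof. by move=> FP i j; rewrite summxE; apply: sle_sum_lub => t _; exact: FP. Qed.

Lemma sle_mx_sum_term m n p (F : 'I_p -> 'M[X]_(m, n)) t :
  sle_mx (F t) (\sum_(s < p) F s).
Proof.
move=> i j; rewrite summxE.
by apply: (sle_sum_term (fun s => F s i j)); rewrite mem_index_enum.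
Qed.

Lemma sle_mulmx m n p (M M' : 'M[X]_(m, n)) (N N' : 'M[X]_(n, p)) :
  sle_mx M M' -> sle_mx N N' -> sle_mx (M *m N) (M' *m N').
Proof.
move=> MM' NN' i j; rewrite !mxE; apply: sle_sum_lub => t _.
apply: sle_trans (sle_mul (MM' i t) (NN' t j)) _.
by apply: (sle_sum_term (fun t => M' i t * N' t j)); rewrite mem_index_enum.
Qed.

Lemma sle_mulmxl m n p (M : 'M[X]_(m, n)) (N N' : 'M[X]_(n, p)) :
  sle_mx N N' -> sle_mx (M *m N) (M *m N').
Proof. by apply: sle_mulmx; exact: sle_mx_refl. Qed.

Lemma regular_sle n (x y : 'cV[X]_n) : sle_mx x y -> regular x -> regular y.
Proof. by move=> xy rx i; apply: sle_neq0 (xy i 0) (rx i). Qed.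

Lemma expmx_sle_stable n p (M : 'M[X]_n) q (z : 'M[X]_(n, q)) :
  sle_mx (M *m z) z -> sle_mx (M ^+ p *m z) z.
Proof.
move=> Mz; elim: p => [|p IHp]; first by rewrite expr0 mul1mx; exact: sle_mx_refl.
by rewrite exprSr -mulmxE -mulmxA; apply: sle_mx_trans IHp; exact: sle_mulmxl.
Qed.

Lemma expmx_diag_sle1_regular n (M : 'M[X]_n) (z : 'cV[X]_n) :
  regular z -> sle_mx (M *m z) z -> forall p i, sle ((M ^+ p) i i) 1.
Proof.
move=> rz Mz p i; apply: (sle_cancel (rz i)).
apply: sle_trans (expmx_sle_stable p Mz i 0); rewrite mxE.
by apply: (sle_sum_term (fun t => (M ^+ p) i t * z t 0)); rewrite mem_index_enum.
Qed.

Lemma Tr_sle1 n (M : 'M[X]_n) :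
  (forall p i, sle ((M ^+ p) i i) 1) -> sle (Tr M) 1.
Proof. by move=> M1; apply: sle_sum_lub => p _; apply: sle_sum_lub. Qed.

Lemma expmx_diag_sle_Tr n (M : 'M[X]_n) p i :
  (0 < p <= n)%N -> sle ((M ^+ p) i i) (Tr M).
Proof.
move=> pn; apply: (@sle_trans _ (\tr (M ^+ p))).
  by apply: (sle_sum_term (fun t => (M ^+ p) t t)); rewrite mem_index_enum.
by apply: (sle_sum_term (fun q => \tr (M ^+ q))); rewrite mem_index_iota.
Qed.

End MatrixOrder.

(** * Walks and the powers of a matrix *)

Section Walks.
Variables (X : idempotentSemifieldType) (n : nat) (M : 'M[X]_n).

(** The walk [f] is a function on all of [nat], so that its segments can be cut
    at any pair of times without changing type. *)
Definition walk_weight (f : nat -> 'I_n) (a b : nat) : X :=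
  \prod_(a <= t < b) M (f t) (f t.+1).

Lemma walk_weight_cat f a b c : (a <= b <= c)%N ->
  walk_weight f a c = walk_weight f a b * walk_weight f b c.
Proof. by case/andP=> ab bc; rewrite /walk_weight (big_cat_nat ab bc). Qed.

Lemma expmx_mul_sle p q i t j :
  sle ((M ^+ p) i t * (M ^+ q) t j) ((M ^+ (p + q)) i j).
Proof.
rewrite exprD -mulmxE mxE.
by apply: (sle_sum_term (fun t => (M ^+ p) i t * (M ^+ q) t j)); rewrite mem_index_enum.
Qed.

Lemma walk_weight_sle f a b : (a <= b)%N ->
  sle (walk_weight f a b) ((M ^+ (b - a)) (f a) (f b)).
Proof.
move=> ab; rewrite -{1 3}(subnKC ab); elim: (b - a)%N => [|p IHp].
  by rewrite addn0 /walk_weight big_geq // expr0 mxE eqxx sle_refl.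
rewrite addnS (@walk_weight_cat f a (a + p)) ?leq_addr ?leqnSn //.
rewrite {2}/walk_weight big_nat1 -[p.+1]addn1.
apply: sle_trans (expmx_mul_sle p 1 _ (f (a + p)%N) _).
by apply: sle_mul IHp _; rewrite expr1 sle_refl.
Qed.

(** An entry of [M^p] is the sum of the weights of the walks with [p] steps, so
    an upper bound of these weights bounds the entry.  The coefficient [c]
    carries the weight of the end of the walk through the induction. *)
Lemma expmx_walk_lub p i j c z :
  (forall f, f 0%N = i -> f p = j -> sle (c * walk_weight f 0 p) z) ->
  sle (c * (M ^+ p) i j) z.
Proof.
elim: p j c => [|p IHp] j c walks_z.
  rewrite expr0 mxE; case: eqP => [ij|_]; last first.
    by rewrite mulr0; apply/eqP; rewrite add0r.
  by have := walks_z (fun=> i) erefl ij; rewrite /walk_weight big_geq.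
rewrite exprSr -mulmxE mxE mulr_sumr; apply: sle_sum_lub => k _.
rewrite mulrA mulrAC; apply: IHp => f f0 fp.
pose g t := if (t <= p)%N then f t else j.
have -> : c * M k j * walk_weight f 0 p = c * walk_weight g 0 p.+1.
  rewrite {2}/walk_weight big_nat_recr //= {3 4}/g leqnn ltnn fp mulrA mulrAC.
  congr (c * _ * _); apply: eq_big_nat => t /andP[_ tp].
  by rewrite /g tp (ltnW tp).
by apply: walks_z; rewrite /g ?leq0n ?ltnn.
Qed.

(** A walk with [n] steps contains a cycle, and removing the cycle can only
    increase the weight. *)
Lemma expmx_size_sle : sle (Tr M) 1 -> sle_mx (M ^+ n) (\sum_(p < n) M ^+ p).
Proof.
move=> TrM i j; rewrite -[(M ^+ n) i j]mul1r; apply: expmx_walk_lub => f f0 fn.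
rewrite mul1r.
(* The [n.+1] vertices visited by the walk cannot be distinct. *)
have [a [b [ab bn fab]]] : exists a b, [/\ (a < b)%N, (b <= n)%N & f a = f b].
  have /injectivePn[x [y xy fxy]] : ~~ injectiveb (fun t : 'I_n.+1 => f t).
    by apply/negP => /injectiveP /leq_card; rewrite !card_ord ltnn.
  move: xy; rewrite -(inj_eq val_inj) /= neq_ltn => /orP[xy|yx].
    by exists x, y; split; rewrite // -ltnS.
  by exists y, x; split; rewrite // -ltnS.
have an : (a + (n - b) < n)%N by rewrite -ltn_subRL ltn_sub2l // (leq_trans ab bn).
have cycle1 : sle (walk_weight f a b) 1.
  apply: sle_trans (walk_weight_sle _ (ltnW ab)) (sle_trans _ TrM).
  rewrite -fab; apply: expmx_diag_sle_Tr.
  by rewrite subn_gt0 ab (leq_trans (leq_subr _ _) bn).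
rewrite (@walk_weight_cat f 0 a n) ?(ltnW (leq_trans ab bn)) //.
rewrite (@walk_weight_cat f a b n) ?(ltnW ab) //.
apply: sle_trans (sle_mul (walk_weight_sle f (leq0n a))
  (sle_mul cycle1 (walk_weight_sle f bn))) _.
rewrite mul1r subn0 f0 fn -fab; apply: sle_trans (expmx_mul_sle _ _ _ _ _) _.
exact: (sle_mx_sum_term (fun p : 'I_n => M ^+ p) (Ordinal an)).
Qed.

End Walks.

(** * The Kleene star *)

Section KleeneStar.
Variables (X : idempotentSemifieldType) (n : nat) (M : 'M[X]_n).
Hypothesis TrM : sle (Tr M) 1.

Let S : 'M[X]_n := \sum_(p < n) M ^+ p.

Let le1S : sle_mx 1%:M S.
Proof.
(* For [n = 0] the sum is empty, but there is no entry to compare. *)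
move=> i j; have n_gt0 : (0 < n)%N := leq_ltn_trans (leq0n i) (ltn_ord i).
exact: (sle_mx_sum_term (fun p : 'I_n => M ^+ p) (Ordinal n_gt0)).
Qed.

Let mulmxS : sle_mx (M *m S) S.
Proof.
rewrite mulmx_sumr; apply: sle_mx_sum_lub => p; rewrite mulmxE -exprS.
have := ltn_ord p; rewrite leq_eqVlt => /predU1P[->|pn]; first exact: expmx_size_sle.
exact: (sle_mx_sum_term (fun p : 'I_n => M ^+ p) (Ordinal pn)).
Qed.

Let expmx_sleS p : sle_mx (M ^+ p) S.
Proof.
apply: sle_mx_trans (expmx_sle_stable p mulmxS).
by rewrite -{1}[M ^+ p]mulmx1; exact: sle_mulmxl.
Qed.

Lemma kleene_starE : kleene_star M = \sum_(p < n) M ^+ p.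
Proof.
have lubS : is_lub_powers M S.
  by split=> // T MT; apply: sle_mx_sum_lub => p; exact: MT.
rewrite /kleene_star; case: xgetP => [T _ [MT lubT]|/(_ S)//].
by apply: sle_mx_anti (lubT _ lubS.1) (lubS.2 _ MT).
Qed.

Lemma kleene_star_ge1 : sle_mx 1%:M (kleene_star M).
Proof. by rewrite kleene_starE. Qed.

Lemma mulmx_kleene_star : sle_mx (M *m kleene_star M) (kleene_star M).
Proof. by rewrite kleene_starE. Qed.

Lemma kleene_star_stable q (z : 'M[X]_(n, q)) :
  sle_mx (M *m z) z -> kleene_star M *m z = z.
Proof.
move=> Mz; apply: sle_mx_anti.
  rewrite kleene_starE mulmx_suml; apply: sle_mx_sum_lub => p.
  exact: expmx_sle_stable.
by rewrite -{1}[z]mul1mx; apply: sle_mulmx kleene_star_ge1 _; exact: sle_mx_refl.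
Qed.

(** The bound by [Tr M] only covers the exponents from [1] to [n]; the star
    extends it to all of them. *)
Lemma expmx_diag_sle1 p i : sle ((M ^+ p) i i) 1.
Proof.
apply: sle_trans (expmx_sleS p i i) _; rewrite summxE.
apply: sle_sum_lub => -[[|q] /= qn] _.
  by rewrite expr0 mxE eqxx sle_refl.
by apply: sle_trans (expmx_diag_sle_Tr _ _ _) TrM; exact: ltnW.
Qed.

End KleeneStar.

(** * The pair of inequalities *)

(** [Tr (B A)] ranges over other exponents than [Tr (A B)] when [k <> n], so
    cyclicity of the trace has to be applied to powers of every exponent. *)
Lemma Tr_mulC_sle1 (X : idempotentSemifieldType) (k n : nat)
    (A : 'M[X]_(k, n)) (B : 'M[X]_(n, k)) :
  sle (Tr (A *m B)) 1 -> sle (Tr (B *m A)) 1.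
Proof.
move=> TrAB.
have expBA p : (B *m A) ^+ p.+1 = B *m ((A *m B) ^+ p *m A).
  elim: p => [|p IHp]; first by rewrite expr1 expr0 mul1mx.
  by rewrite exprS IHp [(A *m B) ^+ p.+1]exprS -!mulmxE !mulmxA.
rewrite /Tr big_nat; apply: sle_sum_lub => -[|p] // _.
rewrite expBA mxtrace_mulC -mulmxA mulmxE -exprSr.
by apply: sle_sum_lub => i _; exact: expmx_diag_sle1.
Qed.

Theorem lemma2 (X : selectiveSemifieldType) (k n : nat)
    (A : 'M[X]_(k, n)) (B : 'M[X]_(n, k)) :
  ((exists (x : 'cV[X]_n) (y : 'cV[X]_k),
      [/\ regular x, regular y & is_solution A B x y])
   <-> sle (Tr (A *m B)) 1)
  /\
  (sle (Tr (A *m B)) 1 ->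
   forall (x : 'cV[X]_n) (y : 'cV[X]_k), regular x -> regular y ->
     (is_solution A B x y <->
      exists (u : 'cV[X]_n) (v : 'cV[X]_k),
        x = kleene_star (B *m A) *m u + B *m kleene_star (A *m B) *m v /\
        y = A *m kleene_star (B *m A) *m u + kleene_star (A *m B) *m v)).
Proof.
have param_solution : sle (Tr (A *m B)) 1 -> forall u v, is_solution A B
    (kleene_star (B *m A) *m u + B *m kleene_star (A *m B) *m v)
    (A *m kleene_star (B *m A) *m u + kleene_star (A *m B) *m v).
  move=> TrAB u v; have TrBA := Tr_mulC_sle1 TrAB.
  split; rewrite mulmxDr !mulmxA; apply: sle_mx_add_lub.
  - exact: sle_mx_addr.
  - apply: sle_mx_trans (sle_mx_addl _ _).
    by apply: sle_mulmx (mulmx_kleene_star TrAB) _; exact: sle_mx_refl.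
  - apply: sle_mx_trans (sle_mx_addr _ _).
    by apply: sle_mulmx (mulmx_kleene_star TrBA) _; exact: sle_mx_refl.
  - exact: sle_mx_addl.
split; first split.
- move=> [x [y [_ ry [Axy Byx]]]]; apply/Tr_sle1/(expmx_diag_sle1_regular ry).
  by rewrite -mulmxA; apply: sle_mx_trans Axy; exact: sle_mulmxl.
- move=> TrAB; have TrBA := Tr_mulC_sle1 TrAB.
  have regular1 m : regular (const_mx 1 : 'cV[X]_m).
    by move=> i; rewrite mxE oner_neq0.
  have regular_star m (M : 'M[X]_m) : sle (Tr M) 1 ->
      regular (kleene_star M *m const_mx 1 : 'cV[X]_m).
    move=> TrM; apply: regular_sle (regular1 m); rewrite -{1}[const_mx 1]mul1mx.
    by apply: sle_mulmx (kleene_star_ge1 TrM) _; exact: sle_mx_refl.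
  have sol := param_solution TrAB (const_mx 1) (const_mx 1).
  do 2![eexists]; split; last exact: sol.
    exact: regular_sle (sle_mx_addr _ _) (regular_star _ _ TrBA).
  exact: regular_sle (sle_mx_addl _ _) (regular_star _ _ TrAB).
move=> TrAB x y _ _; split; last by move=> [u [v [-> ->]]]; exact: param_solution.
move=> [Axy Byx]; exists x, y.
have xE : kleene_star (B *m A) *m x = x.
  apply: kleene_star_stable; first exact: Tr_mulC_sle1.
  by rewrite -mulmxA; apply: sle_mx_trans Byx; exact: sle_mulmxl.
have yE : kleene_star (A *m B) *m y = y.
  apply: kleene_star_stable => //.
  by rewrite -mulmxA; apply: sle_mx_trans Axy; exact: sle_mulmxl.
rewrite -!mulmxA xE yE.
split; apply: sle_mx_anti.
- exact: sle_mx_addr.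
- by apply: sle_mx_add_lub => //; exact: sle_mx_refl.
- exact: sle_mx_addl.
- by apply: sle_mx_add_lub => //; exact: sle_mx_refl.
Qed.
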